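(* Let $A$ be the Szmielew group $$A=\bigoplus_{p\ \text{prime}}\Bigl[\bigoplus_{n>0}\mathbb{Z}(p^n)^{(\kappa_{p,n-1})}\oplus\mathbb{Z}(p^\infty)^{(\lambda_p)}\oplus\mathbb{Z}_{(p)}^{(\mu_p)}\Bigr]\oplus\mathbb{Q}^{(\nu)},$$ where $\kappa_{p,n-1},\lambda_p,\mu_p,\nu$ are cardinals $\le\omega$. For a prime $p$ let $I_p=\{n>0:\kappa_{p,n-1}>0\}$, and if $I_p$ is finite and nonempty let $l_p$ be its maximal element. The following are equivalent: (1) $A$ is discriminating; (2) for any prime $p$ one of the following holds: (i) $\lambda_p=\omega$; (ii) $\lambda_p=0$, and if $I_p$ is finite and nonempty then $\kappa_{p,\,l_p-1}=\omega$.
   Context: $B^{(\kappa)}$ denotes the direct sum of $\kappa$ copies of $B$; $\mathbb{Z}(n)$ is the cyclic group of order $n$; $\mathbb{Z}(p^\infty)$ is the Pr\''ufer $p$-group; $\mathbb{Z}_{(p)}$ is the additive group of rationals with denominator not divisible by $p$; $\mathbb{Q}$ is the additive group of rationals. A group $G$ separates (discriminates) a group $H$ if for any non-identity element (any finite set of non-identity elements) of $H$ there is a homomorphism from $H$ to $G$ which does not map the element (any element of the set) to the identity. A group $G$ is called discriminating if every group separated by $G$ is discriminated by $G$. *)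

(* Defs.v *)
From HB Require Import structures.
From mathcomp Require Import all_boot all_order all_algebra.
From mathcomp Require Import finmap.
From mathcomp Require Import boolp classical_sets cardinality.

Set Implicit Arguments.
Unset Strict Implicit.
Unset Printing Implicit Defensive.

Import GRing.Theory Num.Theory.
Local Open Scope classical_set_scope.
Local Open Scope ring_scope.

Definition separates (G H : groupType) : Prop :=
  forall x : H, x <> 1%g ->
    exists f : UMagmaMorphism.type H G, f x <> 1%g.

Definition discriminates (G H : groupType) : Prop :=
  forall S : set H, finite_set S -> (forall x, S x -> x <> 1%g) ->
    exists f : UMagmaMorphism.type H G, forall x, S x -> f x <> 1%g.

Definition discriminating (G : groupType) : Prop :=
  forall H : groupType, separates G H -> discriminates G H.

(* The cardinals at most omega: [Fin n] is n, [Omega] is omega. *)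
Inductive countable_cardinal : Type := Fin of nat | Omega.

Definition card_index (c : countable_cardinal) : Type :=
  match c with Fin n => 'I_n | Omega => nat end.

Definition prime_nat : Type := {p : nat | prime p}.

Section DirectSum.
Variables (I : Type) (V : I -> zmodType).

Record direct_sum : Type := DirectSum {
  dsum_fun :> forall i, V i;
  dsum_finsupp : finite_set [set i | dsum_fun i <> 0]
}.

Implicit Types f g : direct_sum.

Lemma direct_sum_ext f g : (forall i, f i = g i) -> f = g.
Proof.
case: f g => [f fP] [g gP] /= fg.
have E : f = g by exact: functional_extensionality_dep.
by case: _ / E in gP fg *; congr DirectSum; exact: Prop_irrelevance.
Qed.

Lemma dsum_zero_subproof : finite_set [set i : I | (0 : V i) <> 0].
Proof. by apply: sub_finite_set (@finite_set0 I) => i /=; exact. Qed.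
Definition dsum_zero := DirectSum dsum_zero_subproof.

Lemma dsum_opp_subproof f : finite_set [set i | - f i <> 0].
Proof.
apply: sub_finite_set (dsum_finsupp f) => i /= fi0 fi.
by apply: fi0; rewrite fi oppr0.
Qed.
Definition dsum_opp f := DirectSum (dsum_opp_subproof f).

Lemma dsum_add_subproof f g : finite_set [set i | f i + g i <> 0].
Proof.
apply: (@sub_finite_set _ _ ([set i | f i <> 0] `|` [set i | g i <> 0])).
  move=> i /= fgi; have [fi|/eqP fi] := eqVneq (f i) 0; last by left.
  by right=> gi; apply: fgi; rewrite fi gi addr0.
by rewrite finite_setU; split; exact: dsum_finsupp.
Qed.
Definition dsum_add f g := DirectSum (dsum_add_subproof f g).

HB.instance Definition _ := gen_eqMixin direct_sum.
HB.instance Definition _ := gen_choiceMixin direct_sum.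

Lemma dsum_addA : associative dsum_add.
Proof. by move=> f g h; apply: direct_sum_ext => i /=; rewrite addrA. Qed.
Lemma dsum_addC : commutative dsum_add.
Proof. by move=> f g; apply: direct_sum_ext => i /=; rewrite addrC. Qed.
Lemma dsum_add0 : left_id dsum_zero dsum_add.
Proof. by move=> f; apply: direct_sum_ext => i /=; rewrite add0r. Qed.
Lemma dsum_addN : left_inverse dsum_zero dsum_opp dsum_add.
Proof. by move=> f; apply: direct_sum_ext => i /=; rewrite addNr. Qed.

HB.instance Definition _ :=
  GRing.isZmodule.Build direct_sum dsum_addA dsum_addC dsum_add0 dsum_addN.

End DirectSum.

Definition copies (c : countable_cardinal) (B : zmodType) : zmodType :=
  direct_sum (fun _ : card_index c => B).

Lemma denq_sub_dvd (x y : rat) :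
  (`|denq (x - y)| %| `|denq x| * `|denq y|)%N.
Proof.
have Dx : (denq x)%:Q != 0 by rewrite intr_eq0 denq_neq0.
have Dy : (denq y)%:Q != 0 by rewrite intr_eq0 denq_neq0.
have E : x - y = (numq x * denq y - numq y * denq x)%:~R
                 / (denq x * denq y)%:~R.
  rewrite -{1}[x]divq_num_den -{1}[y]divq_num_den.
  rewrite -mulNr addf_div //.
  by rewrite intrM intrB !intrM mulNr.
have d0 : denq x * denq y != 0 by rewrite mulf_neq0 ?denq_neq0.
rewrite E -abszM; case: (divqP _ _) d0 => [//|k z k0 _].
by rewrite abszM dvdn_mull.
Qed.

Section PrimeComponents.
Variable p : prime_nat.

Definition zlocal_pred : {pred rat} :=
  [pred x : rat | ~~ (val p %| `|denq x|)%N].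

Lemma zlocal_closed : zmod_closed zlocal_pred.
Proof.
have pp : prime (val p) := valP p.
split=> [|x y]; rewrite !inE ?Euclid_dvd1 // => px py.
apply/negP => /dvdn_trans/(_ (denq_sub_dvd x y)).
by rewrite Euclid_dvdM // (negPf px) (negPf py).
Qed.
HB.instance Definition _ := GRing.isZmodClosed.Build rat zlocal_pred zlocal_closed.

Definition zlocal : Type := {x : rat | x \in zlocal_pred}.
HB.instance Definition _ := SubChoice.on zlocal.
HB.instance Definition _ := [SubChoice_isSubZmodule of zlocal by <:].

(* Z[1/p]: the rationals whose denominator is a power of p. *)
Definition zinv_pred : {pred rat} :=
  [pred x : rat | (val p).-nat `|denq x|%N].

Lemma zinv_closed : zmod_closed zinv_pred.
Proof.
split=> [|x y]; rewrite !inE // => px py.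
by apply: pnat_dvd (denq_sub_dvd x y) _; rewrite pnatM px py.
Qed.
HB.instance Definition _ := GRing.isZmodClosed.Build rat zinv_pred zinv_closed.

Definition zinv : Type := {x : rat | x \in zinv_pred}.
HB.instance Definition _ := SubChoice.on zinv.
HB.instance Definition _ := [SubChoice_isSubZmodule of zinv by <:].

Definition zinv_int : {pred zinv} := [pred x : zinv | val x \is a Num.int].

Lemma zinv_int_closed : zmod_closed zinv_int.
Proof.
split=> [|x y]; rewrite !inE ?raddf0 ?rpred0 // raddfB => hx hy.
exact: rpredB.
Qed.
HB.instance Definition _ := GRing.isZmodClosed.Build zinv zinv_int zinv_int_closed.

(* The Pruefer p-group, as Z[1/p] / Z. *)
Definition prufer : zmodType := Quotient.quot zinv_int.

End PrimeComponents.

Section Szmielew.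
Variables (kappa : prime_nat -> nat -> countable_cardinal)
          (lambda mu : prime_nat -> countable_cardinal)
          (nu : countable_cardinal).

(* The sum over n > 0 is indexed by k = n - 1. *)
Definition szmielew : zmodType :=
  (direct_sum (fun p : prime_nat =>
     (direct_sum (fun k : nat => copies (kappa p k) 'Z_(val p ^ k.+1))
      * copies (lambda p) (prufer p)
      * copies (mu p) (zlocal p))%type : zmodType)
   * copies nu rat)%type.

Definition cyclic_exponents (p : prime_nat) : set nat :=
  [set n | (0 < n)%N /\ kappa p n.-1 <> Fin 0].

(* A maximum only if [cyclic_exponents p] is finite and nonempty; 0 if it is
   empty or infinite. *)
Definition max_cyclic_exponent (p : prime_nat) : nat :=
  (\max_(n <- fset_set (cyclic_exponents p)) n)%N.

End Szmielew.

(* Main.v *)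
(** Write A as a sum of coordinate groups W_j, each cyclic, Pruefer, Z_(p) or Q,
with inclusions W_j -> A and projections A -> W_j.

Sufficiency: let A separate H and let x_1, ..., x_n be non-trivial in H. Each
x_i is detected by a homomorphism to some W_j. If W_j is torsion-free, a generic
integer multiple of this homomorphism can be added to one already built
without creating zeros. Otherwise condition (2) provides infinitely many
coordinates into which W_j maps without killing the given element, so that a
coordinate not used before is available.

Necessity: if (2) fails at p, consider X(G), the set of the x in G with p x = 0
that are divisible by all powers of p (if lambda_p is finite and nonzero), or by
p^(l_p - 1) (otherwise). It is functorial, compatible with products, and X(A) is
finite and nonzero. Were A discriminating, some homomorphism A x A -> A would
be injective on X(A) x X(A), with values in X(A), which is absurd. *)

Require Import Defs.
From HB Require Import structures.
From mathcomp Require Import all_boot all_order all_algebra.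
From mathcomp Require Import finmap generic_quotient.
From mathcomp Require Import boolp classical_sets functions cardinality.

Set Implicit Arguments.
Unset Strict Implicit.
Unset Printing Implicit Defensive.

Import Order.TTheory GRing.Theory Num.Theory.
Local Open Scope classical_set_scope.
Local Open Scope quotient_scope.
Local Open Scope ring_scope.

(** Classically [I] carries a choice structure, and over a type with decidable equality the second
    component of a dependent pair is determined. *)
Lemma existT_inj (I : Type) (T : I -> Type) i (x y : T i) :
  existT T i x = existT T i y -> x = y.
Proof. by elim/Pchoice: I => I in T i x y *; exact: eq_from_Tagged. Qed.

(** * Coordinates of a sum *)

(* As only finitely many coordinates are used at a time, the [cproj] are not
   required to be finitely supported: this covers both sums and products. *)
Record coordinates (G : zmodType) (J : Type) (W : J -> zmodType) :=
  Coordinates {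
  cinj : forall j, {additive W j -> G};
  cproj : forall j, {additive G -> W j};
  cprojK : forall j x, cproj j (cinj j x) = x;
  cproj_neq : forall i j x, i <> j -> cproj i (cinj j x) = 0;
  cproj_sep : forall x, x <> 0 -> exists j, cproj j x <> 0
}.

Definition sum_family (J K : Type) (W : J -> zmodType) (U : K -> zmodType)
    (j : J + K) : zmodType :=
  match j with inl a => W a | inr b => U b end.

Definition sigma_family (J : Type) (K : J -> Type)
    (U : forall j, K j -> zmodType)
    (j : {j & K j}) : zmodType :=
  U (projT1 j) (projT2 j).

Section Single.
Variables (I : Type) (V : I -> zmodType) (i : I).

Definition single_fun (v : V i) (j : I) : V j :=
  match pselect (i = j) with
  | left e => ecast j (V j) e v
  | right _ => 0
  end.

Lemma single_funE v : single_fun v i = v.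
Proof.
rewrite /single_fun; case: pselect => // e.
by rewrite (Prop_irrelevance e erefl).
Qed.

Lemma single_fun_neq v j : i <> j -> single_fun v j = 0.
Proof. by rewrite /single_fun; case: pselect. Qed.

Lemma single_finsupp v : finite_set [set j | single_fun v j <> 0].
Proof.
apply: sub_finite_set (finite_set1 i) => j /= vj.
by apply: contrapT => ji; apply: vj; apply: single_fun_neq => /esym.
Qed.

Definition single v : direct_sum V := DirectSum (single_finsupp v).

Lemma single_is_zmod_morphism : zmod_morphism single.
Proof.
move=> v w; apply: direct_sum_ext => j /=.
have [<-|ij] := pselect (i = j); first by rewrite !single_funE.
by rewrite !single_fun_neq // subr0.
Qed.
HB.instance Definition _ :=
  GRing.isZmodMorphism.Build (V i) (direct_sum V) single
    single_is_zmod_morphism.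

Definition dsum_coord (f : direct_sum V) : V i := f i.

Lemma dsum_coord_is_zmod_morphism : zmod_morphism dsum_coord.
Proof. by []. Qed.
HB.instance Definition _ := GRing.isZmodMorphism.Build (direct_sum V) (V i)
  dsum_coord dsum_coord_is_zmod_morphism.

End Single.

Definition dsum_coordinates (I : Type) (V : I -> zmodType) :
  coordinates (direct_sum V) V.
Proof.
exists (fun i => @single I V i) (fun i => @dsum_coord I V i).
- by move=> j x; exact: single_funE.
- by move=> i j x ij; apply: single_fun_neq => /esym.
- move=> f f0; apply: contrapT => /forallNP fE; apply: f0.
  by apply: direct_sum_ext => i; apply: contrapT; exact: fE.
Defined.

Definition inl_fun (G H : zmodType) (x : G) : G * H := (x, 0).
Definition inr_fun (G H : zmodType) (y : H) : G * H := (0, y).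
Lemma inl_is_zmod_morphism (G H : zmodType) : zmod_morphism (@inl_fun G H).
Proof. by move=> x y; rewrite /inl_fun -[RHS]/(_, _) /= subr0. Qed.
Lemma inr_is_zmod_morphism (G H : zmodType) : zmod_morphism (@inr_fun G H).
Proof. by move=> x y; rewrite /inr_fun -[RHS]/(_, _) /= subr0. Qed.
HB.instance Definition _ (G H : zmodType) :=
  GRing.isZmodMorphism.Build G (G * H)%type (@inl_fun G H)
    (@inl_is_zmod_morphism G H).
HB.instance Definition _ (G H : zmodType) :=
  GRing.isZmodMorphism.Build H (G * H)%type (@inr_fun G H)
    (@inr_is_zmod_morphism G H).

Definition pair_coordinates (G H : zmodType) (J K : Type)
    (W : J -> zmodType) (U : K -> zmodType)
    (C : coordinates G W) (D : coordinates H U) :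
  coordinates (G * H)%type (sum_family W U).
Proof.
exists (fun j => match j return {additive sum_family W U j -> (G * H)%type} with
          | inl a => (@inl_fun G H \o cinj C a) : {additive W a -> (G * H)%type}
          | inr b => (@inr_fun G H \o cinj D b) : {additive U b -> (G * H)%type}
          end)
       (fun j => match j return {additive (G * H)%type -> sum_family W U j} with
          | inl a => (cproj C a \o fst) : {additive (G * H)%type -> W a}
          | inr b => (cproj D b \o snd) : {additive (G * H)%type -> U b} end).
- by case=> j x /=; rewrite cprojK.
- case=> i [] j x ij /=; rewrite ?raddf0 // cproj_neq // => e; apply: ij;
    by rewrite e.
- move=> [x y] xy0; have [x0|x0] := pselect (x = 0).
    have /(cproj_sep D)[b yb] : y <> 0 by move=> y0; apply: xy0; rewrite x0 y0.
    by exists (inr b).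
  by have [a xa] := cproj_sep C x0; exists (inl a).
Defined.

Definition refine_coordinates (G : zmodType) (J : Type) (W : J -> zmodType)
    (K : J -> Type) (U : forall j, K j -> zmodType)
    (C : coordinates G W) (D : forall j, coordinates (W j) (U j)) :
  coordinates G (sigma_family U).
Proof.
exists (fun j => (cinj C (projT1 j) \o cinj (D (projT1 j)) (projT2 j))
           : {additive sigma_family U j -> G})
       (fun j => (cproj (D (projT1 j)) (projT2 j) \o cproj C (projT1 j))
           : {additive G -> sigma_family U j}).
- by move=> [j k] x /=; rewrite !cprojK.
- move=> [i k] [j l] x /= ne.
  have [ij|ij] := pselect (i = j); last by rewrite (cproj_neq C) // raddf0.
  case: _ / ij in l x ne *; rewrite cprojK cproj_neq // => e; apply: ne.
  by rewrite e.
- move=> x x0; have [j xj] := cproj_sep C x0; have [k xk] := cproj_sep (D j) xj.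
  by exists (existT _ j k).
Defined.

(** * Homomorphisms without zeros on a finite set *)

Definition torsion_free (G : zmodType) :=
  forall (x : G) n, (0 < n)%N -> x *+ n = 0 -> x = 0.

(** [H] is multiplicative and possibly non-abelian, hence an equation on bare functions. *)
Definition grp_additive (H : groupType) (G : zmodType) (f : H -> G) :=
  forall x y, f (x * y)%g = f x + f y.

(* [a + b *+ n] vanishes for at most one [n]. *)
Lemma avoid_zero_combinations (T : eqType) (G : zmodType) (s : seq T)
    (a b : T -> G) : torsion_free G ->
  exists2 n, (0 < n)%N &
    forall t, t \in s -> a t <> 0 \/ b t <> 0 -> a t + b t *+ n <> 0.
Proof.
move=> tfG.
(* Bounds beyond which no zero occurs can be combined over the list by a maximum. *)
suff [N NP] : exists N, forall n t, (N < n)%N -> t \in s ->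
    a t <> 0 \/ b t <> 0 -> a t + b t *+ n <> 0.
  by exists N.+1 => // t; exact: NP.
elim: s => [|t s [N NP]]; first by exists 0%N.
suff [M MP] : exists M, forall n, (M < n)%N ->
    a t <> 0 \/ b t <> 0 -> a t + b t *+ n <> 0.
  exists (maxn M N) => n u; rewrite gtn_max => /andP[Mn Nn].
  by rewrite inE => /predU1P[->|]; [exact: MP|exact: NP].
have [[m ->]|noz] := pselect (exists m, a t = - (b t *+ m)); last first.
  by exists 0%N => n _ _ /eqP; rewrite addr_eq0 => /eqP e; apply: noz; exists n.
(* For [n > m] the sum is [b t *+ (n - m)]; its vanishing forces [b t = 0], and then [a t = 0]. *)
exists m => n mn ab; rewrite addrC -mulrnBr ?(ltnW mn) // => /tfG.
rewrite subn_gt0 => /(_ mn) b0; case: ab => //.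
by rewrite b0 mul0rn oppr0.
Qed.

Section Discriminate.
Variables (H : groupType) (G : zmodType) (J : Type) (W : J -> zmodType).
Variable C : coordinates G W.

Definition detects (x : H) (j : J) :=
  exists2 g : H -> W j, grp_additive g & g x <> 0.

Lemma coordinates_discriminate (s : seq H) :
  (forall x, x \in s ->
     infinite_set (detects x) \/ exists2 j, torsion_free (W j) & detects x j) ->
  exists2 f : H -> G, grp_additive f & forall x, x \in s -> f x <> 0.
Proof.
move=> sP; suff [f [fD _] fs] : exists2 f : H -> G,
    grp_additive f /\ (exists2 F, finite_set F &
      forall j x, ~ F j -> cproj C j (f x) = 0) &
    forall x, x \in s -> exists j, cproj C j (f x) <> 0.
  exists f => // x /fs[j fx] fx0; apply: fx; by rewrite fx0 raddf0.
elim: s => [|x s IHs] in sP *.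
  exists (fun=> 0) => //; split=> [x y|]; first by rewrite addr0.
  by exists set0 => // j x _; rewrite raddf0.
have {}IHs := IHs (fun y ys => sP y (mem_behead (s := x :: s) ys)).
have {IHs} [f [fD [F finF fF]] fs] := IHs.
have [j [n [g [gD g0 n0 gs]]]] : exists j, exists n : nat, exists g : H -> W j,
    [/\ grp_additive g, g x <> 0, (0 < n)%N & forall y, y \in x :: s ->
     cproj C j (f y) <> 0 \/ g y <> 0 -> cproj C j (f y) + g y *+ n <> 0].
  have [inf|[j tf [g gD gx]]] := sP x (mem_head _ _).
    have /infinite_setN0[j [[g gD gx] Fj]] := infinite_setD inf finF.
    exists j, 1%N, g; split=> // y _; rewrite fF // add0r mulr1n.
    by case.
  have [n n0 nP] := avoid_zero_combinations (x :: s)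
    (fun y => cproj C j (f y)) g tf.
  by exists j, n, g.
exists (fun y => f y + cinj C j (g y *+ n)).
  split=> [y z|]; first by rewrite fD gD mulrnDl raddfD addrACA.
  exists (F `|` [set j]); first by rewrite finite_setU.
  move=> i y /not_orP[Fi ij]; rewrite raddfD /= fF // add0r.
  exact: (cproj_neq C).
(* If neither [f] nor [g] sees [y] in coordinate [j], then [y] is an old element whose nonzero
   coordinate differs from [j] and is unchanged. *)
move=> y ys; have [gy|gy] := pselect (cproj C j (f y) <> 0 \/ g y <> 0).
  by exists j; rewrite raddfD /= cprojK; exact: gs.
move: ys; rewrite inE => /predU1P[yx|ys].
  by case: gy; right; rewrite yx.
have [i fi] := fs _ ys; exists i; have [ij|ij] := pselect (i = j).
  by case: gy; left; rewrite -ij.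
by rewrite raddfD /= (cproj_neq C) // addr0.
Qed.

End Discriminate.

(** * Cyclic and Pruefer groups *)

Lemma mulrn_gcd (G : zmodType) (x : G) m n :
  x *+ m = 0 -> x *+ n = 0 -> x *+ gcdn m n = 0.
Proof.
case: m => [|m]; first by rewrite gcd0n.
move=> xm xn; case: (egcdnP n (ltn0Sn m)) => km kn e _.
have : x *+ (km * m.+1) = x *+ (kn * n + gcdn m.+1 n) by rewrite e.
by rewrite mulrnDr (mulnC km) (mulnC kn) !mulrnA xm xn !mul0rn add0r.
Qed.

Lemma coprime_mulrn_eq0 (G : zmodType) (x : G) m n :
  coprime m n -> x *+ m = 0 -> x *+ n = 0 -> x = 0.
Proof. by move=> /eqP mn /mulrn_gcd/[apply]; rewrite mn. Qed.

Section CyclicMap.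
Variables (G : zmodType) (n : nat) (w : G).
Hypotheses (n1 : (1 < n)%N) (wn : w *+ n = 0).

Lemma mulrn_modn m : w *+ (m %% n) = w *+ m.
Proof. by rewrite {2}(divn_eq m n) mulrnDr mulnC mulrnA wn mul0rn add0r. Qed.

Lemma cyclic_map_additive : zmod_morphism (fun x : 'Z_n => w *+ x).
Proof.
have D (x y : 'Z_n) : w *+ (x + y)%R = w *+ x + w *+ y.
  rewrite -mulrnDr -(mulrn_modn (x + y)%N); congr (_ *+ _).
  exact: (congr1 (modn _) (Zp_cast n1)).
by move=> x y; apply/eqP; rewrite eq_sym subr_eq -D subrK.
Qed.

End CyclicMap.

Lemma expn_prime_gt1 p k : prime p -> (1 < p ^ k.+1)%N.
Proof. by move=> pp; rewrite -{1}(expn0 p) ltn_exp2l ?prime_gt1. Qed.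

(** As [w] has order exactly [p ^ k.+1], the map [x |-> w *+ x] is well defined and injective: if it
    killed [v], then [w] would be killed by the gcd of [v] and [p ^ k.+1], a divisor of [p ^ k]. *)
Lemma cyclic_map (G : zmodType) (p k : nat) (w : G) (v : 'Z_(p ^ k.+1)) :
  prime p -> w *+ (p ^ k) <> 0 -> w *+ (p ^ k.+1) = 0 -> v <> 0 ->
  exists h : {additive 'Z_(p ^ k.+1) -> G}, h v <> 0.
Proof.
move=> pp wk wk1 v0; have pk1 := expn_prime_gt1 k pp.
pose hM := GRing.isZmodMorphism.Build _ _ _ (cyclic_map_additive pk1 wk1).
pose h : {additive 'Z_(p ^ k.+1) -> G} :=
  HB.pack (fun x : 'Z_(p ^ k.+1) => w *+ x) hM.
exists h => /= hv; apply: wk.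
have := mulrn_gcd hv wk1; set g := gcdn _ _ => wg.
have /(dvdn_pfactor _ _ pp)[m mk gE] : (g %| p ^ k.+1)%N by exact: dvdn_gcdr.
have /dvdnP[q ->] : (g %| p ^ k)%N.
  rewrite gE dvdn_exp2l // -ltnS ltn_neqAle mk andbT; apply/eqP => mE.
  have vlt : (v < p ^ k.+1)%N := leq_trans (ltn_ord v) (eq_leq (Zp_cast pk1)).
  have := dvdn_gcdl v (p ^ k.+1); rewrite -/g gE mE.
  case: (posnP v) => [v00 _|vpos /(dvdn_leq vpos)]; last by rewrite leqNgt vlt.
  by apply: v0; exact: val_inj.
by rewrite mulnC mulrnA wg mul0rn.
Qed.

Lemma Zp_mulrn_eq0 n (x : 'Z_n) : (1 < n)%N -> x *+ n = 0.
Proof. by move=> n1; rewrite -mulr_natr pchar_Zp // mulr0. Qed.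

Lemma cyclic_map_cyclic p k l (v : 'Z_(p ^ k.+1)) : prime p -> (k <= l)%N ->
  v <> 0 -> exists h : {additive 'Z_(p ^ k.+1) -> 'Z_(p ^ l.+1)}, h v <> 0.
Proof.
move=> pp kl; have pl := expn_prime_gt1 l pp.
(* The element [p ^ (l - k)] has order [p ^ k.+1] in the target. *)
apply: (cyclic_map (w := (1 *+ (p ^ (l - k)) : 'Z_(p ^ l.+1))) pp).
  rewrite -mulrnA -expnD subnK // => /(congr1 val) /=.
  rewrite val_Zp_nat // modn_small ?ltn_exp2l ?prime_gt1 // => /eqP.
  by rewrite expn_eq0 -leqn0 leqNgt prime_gt0.
by rewrite -mulrnA -expnD addnS subnK // Zp_mulrn_eq0.
Qed.

Section Prufer.
Variable p : prime_nat.
Let pp : prime (val p) := valP p.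

Lemma pinv_subproof k : ((val p ^ k)%:R^-1 : rat) \in zinv_pred p.
Proof.
rewrite inE -[X in X^-1]/(((val p ^ k)%:Z)%:~R) denqVz.
  by rewrite !absz_nat pnatX pnat_id.
by rewrite eqz_nat -lt0n expn_gt0 prime_gt0.
Qed.

Definition zinv_pinv k : zinv p := Sub (_ : rat) (pinv_subproof k).

(** The class of 1/p^k, of order p^k. *)
Definition prufer_gen k : prufer p := \pi_(prufer p) (zinv_pinv k).

Lemma prufer_eq0 (a : zinv p) : \pi_(prufer p) a = 0 <-> val a \is a Num.int.
Proof.
rewrite -[0](raddf0 (\pi_(prufer p))); split.
  by move=> /eqP; rewrite -Quotient.idealrBE subr0.
by move=> ai; apply/eqP; rewrite -Quotient.idealrBE subr0.
Qed.

Lemma prufer_gen0 : prufer_gen 0 = 0.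
Proof. by apply/prufer_eq0; rewrite /= expn0 invr1. Qed.

Lemma prufer_gen1 : prufer_gen 1 <> 0.
Proof.
move=> /prufer_eq0/intrP[z] /=; rewrite expn1 => e.
have p0 : (val p)%:R != 0 :> rat by rewrite pnatr_eq0 -lt0n prime_gt0.
have /intr_inj/(congr1 absz) : (z * (val p)%:Z)%:~R = 1%:~R :> rat.
  by rewrite intrM -e mulVf.
rewrite abszM absz_nat => /eqP; rewrite muln_eq1 => /andP[_ /eqP p1].
by have := prime_gt1 pp; rewrite p1.
Qed.

Lemma prufer_genM k m : prufer_gen (k + m) *+ (val p ^ m) = prufer_gen k.
Proof.
rewrite -raddfMn; congr (\pi_ _ _); apply: val_inj; rewrite raddfMn /=.
rewrite -[LHS]mulr_natr expnD natrM invfM -mulrA mulVf ?mulr1 //.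
by rewrite pnatr_eq0 -lt0n expn_gt0 prime_gt0.
Qed.

Lemma prufer_torsion (x : prufer p) : exists e, x *+ (val p ^ e) = 0.
Proof.
rewrite -[x]reprK; set a := repr x.
have : (val p).-nat `|denq (val a)|%N := valP a.
move=> /p_natP[e aE]; exists e; rewrite -raddfMn.
apply/prufer_eq0; rewrite raddfMn /= -aE -mulr_natr.
rewrite -[X in X * _]divq_num_den natr_absz ger0_norm ?denq_ge0 //.
by rewrite divfK ?intr_eq0 ?denq_neq0 // intr_int.
Qed.

(** A representative is z/p with z an integer; replacing z by its remainder modulo p changes it by
    the integer quotient. *)
Lemma prufer_socle (x : prufer p) :
  x *+ val p = 0 -> exists m, (m < val p)%N /\ x = prufer_gen 1 *+ m.
Proof.
rewrite -[x]reprK; set a := repr x.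
rewrite -raddfMn => /prufer_eq0/intrP[z]; rewrite raddfMn => az.
have pz : (val p)%:Z != 0 by rewrite eqz_nat -lt0n prime_gt0.
exists `|(z %% val p)%Z|%N; split.
  by rewrite -ltz_nat gez0_abs ?modz_ge0 // ltz_pmod // ltz_nat prime_gt0.
rewrite -raddfMn; apply/eqP; rewrite -Quotient.idealrBE.
rewrite -[_ \in _]/(val (a - _) \is a Num.int) raddfB raddfMn /=.
have p0 : (val p)%:R != 0 :> rat by rewrite pnatr_eq0 -lt0n prime_gt0.
rewrite (_ : _ - _ = (z %/ val p)%Z%:~R) ?intr_int //.
apply: (mulIf p0); rewrite mulrBl mulr_natr az -[X in X * _]mulr_natr mulrAC.
rewrite expn1 mulVf // mul1r natr_absz ger0_norm ?modz_ge0 //.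
by apply/eqP; rewrite subr_eq {1}(divz_eq z (val p)) intrD intrM.
Qed.

End Prufer.

Lemma cyclic_map_prufer (p : prime_nat) k (v : 'Z_(val p ^ k.+1)) : v <> 0 ->
  exists h : {additive 'Z_(val p ^ k.+1) -> prufer p}, h v <> 0.
Proof.
apply: (cyclic_map (w := prufer_gen p k.+1) (valP p)).
  by rewrite -add1n prufer_genM; exact: prufer_gen1.
by rewrite -{1}[k.+1]add0n prufer_genM prufer_gen0.
Qed.

(** * Divisible socles *)

Section DivisibleSocle.
Variables (p : nat) (M : set nat).

(** The set X(G). The parameter [M] unites the two cases: [setT] asks for divisibility by all powers
    of p, a singleton for divisibility by one power. *)
Definition divisible_socle (G : zmodType) : set G :=
  [set x | x *+ p = 0 /\ forall m, M m -> exists y, x = y *+ (p ^ m)].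

Lemma divisible_socle_additive (G H : zmodType) (f : {additive G -> H}) x :
  divisible_socle x -> divisible_socle (f x).
Proof.
move=> [px xM]; split=> [|m /xM[y ->]]; first by rewrite -raddfMn px raddf0.
by exists (f y); rewrite raddfMn.
Qed.

Lemma divisible_socleN (G : zmodType) (x : G) :
  divisible_socle x -> divisible_socle (- x).
Proof.
move=> [px xM]; split=> [|m /xM[y ->]]; first by rewrite mulNrn px oppr0.
by exists (- y); rewrite mulNrn.
Qed.

Lemma divisible_socleD (G : zmodType) (x y : G) :
  divisible_socle x -> divisible_socle y -> divisible_socle (x + y).
Proof.
move=> [px xM] [py yM]; split=> [|m Mm]; first by rewrite mulrnDl px py addr0.
have [z ->] := xM _ Mm; have [t ->] := yM _ Mm.
by exists (z + t); rewrite mulrnDl.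
Qed.

Lemma divisible_socle0 (G : zmodType) : divisible_socle (0 : G).
Proof. by split=> [|m _]; [rewrite mul0rn|exists 0; rewrite mul0rn]. Qed.

Lemma torsion_free_divisible_socle (G : zmodType) (x : G) : prime p ->
  torsion_free G -> divisible_socle x -> x = 0.
Proof. by move=> /prime_gt0 p0 tf [/(tf _ _ p0)]. Qed.

Lemma cyclic_divisible_socle k m (x : 'Z_(p ^ k.+1)) : prime p ->
  M m -> (k < m)%N -> divisible_socle x -> x = 0.
Proof.
move=> pp Mm km [_ /(_ _ Mm)[y ->]]; rewrite -(subnKC km) expnD mulrnA.
by rewrite (Zp_mulrn_eq0 _ (expn_prime_gt1 k pp)) mul0rn.
Qed.

Lemma coprime_divisible_socle (G : zmodType) n (x : G) :
  coprime p n -> x *+ n = 0 -> divisible_socle x -> x = 0.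
Proof. by move=> pn xn [xp _]; exact: coprime_mulrn_eq0 pn xp xn. Qed.

(** Projections preserve X, so an element of X(G) vanishes outside [F]; as coordinates separate, it
    is determined by finitely many entries, each from a finite set. *)
Lemma divisible_socle_coordinates_finite (G : zmodType) (J : Type)
    (W : J -> zmodType) (C : coordinates G W) (F : set J) :
  finite_set F ->
  (forall j, ~ F j -> forall x : W j, divisible_socle x -> x = 0) ->
  (forall j, F j -> finite_set (@divisible_socle (W j))) ->
  finite_set (@divisible_socle G).
Proof.
move=> finF F0 Ffin.
pose X (E : set J) := [set x : G | divisible_socle x /\
  forall j, ~ E j -> cproj C j x = 0].
suff : finite_set (X F).
  apply: sub_finite_set => x xX; split=> // j Fj; apply: (F0 j Fj).
  exact: divisible_socle_additive.
suff : forall E, finite_set E -> E `<=` F -> finite_set (X E) by apply.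
move=> {F0 finF}; elim/Pchoice: J => J in W C F Ffin X *.
move=> _ /finite_seqP[s ->]; elim: s => [|j s IHs] sF.
  apply: sub_finite_set (finite_set1 0) => x [_ x0]; apply: contrapT.
  by move=> /(cproj_sep C)[j]; apply; apply: x0.
have {}IHs : finite_set (X [set` s]).
  by apply: IHs => i /= si; apply: sF; rewrite /= inE si orbT.
have finj : finite_set (@divisible_socle (W j)).
  by apply: Ffin; apply: sF; rewrite /= mem_head.
(* Each [x] is its part in coordinate [j] plus a remainder supported on [s]. *)
apply: sub_finite_set (finite_image (fun y => cinj C j y.1 + y.2)
  (finite_setX finj IHs)) => x [xX x0].
have xjX : divisible_socle (cproj C j x) by exact: divisible_socle_additive.
exists (cproj C j x, x - cinj C j (cproj C j x)); last by rewrite addrC subrK.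
split=> //=; split.
  apply: divisible_socleD => //.
  exact/divisible_socleN/divisible_socle_additive.
move=> i si; rewrite raddfB /=; have [->|/eqP ij] := eqVneq i j.
  by rewrite cprojK subrr.
rewrite (cproj_neq C) // subr0; apply: x0 => /=.
by rewrite inE => /predU1P[|].
Qed.

(** The two projections separate [G * G]. A homomorphism [F] nonzero on the finitely many nonzero
    pairs from X(G) would already map the first factor X(G) onto X(G), leaving no room for the
    second. *)
Lemma finite_divisible_socle_not_discriminating (G : zmodType) (x0 : G) :
  finite_set (@divisible_socle G) -> divisible_socle x0 -> x0 <> 0 ->
  ~ discriminating (GRing.to_multiplicative G).
Proof.
move=> finX Xx0 x00 disc.
pose H := GRing.to_multiplicative (G * G)%type : groupType.
have sepH : separates (GRing.to_multiplicative G) H.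
  move=> [a b] ab0; have [a0|a0] := pselect (a = 0); last first.
    by exists (GRing.to_fmultiplicative (fst : {additive G * G -> G})).
  exists (GRing.to_fmultiplicative (snd : {additive G * G -> G})) => /= b0.
  by apply: ab0; rewrite a0; congr (_, _).
pose S : set H := [set z : (G * G)%type | (divisible_socle z.1 /\
   divisible_socle z.2) /\ z <> 0].
have finS : finite_set S.
  apply: (@sub_finite_set _ _ (@divisible_socle G `*` @divisible_socle G)).
    by move=> z [].
  exact: finite_setX.
have [f fS] := disc H sepH S finS (fun z Sz => proj2 Sz).
have f0 : f (0, 0) = 0 := @gmulf1 _ _ f.
pose fM := GRing.isNmodMorphism.Build (G * G)%type G f (f0, @gmulfM _ _ f).
pose F : {additive (G * G)%type -> G} := HB.pack (f : (G * G)%type -> G) fM.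
have F0 a b : divisible_socle a -> divisible_socle b -> F (a, b) = 0 ->
    a = 0 /\ b = 0.
  move=> aX bX Fab; apply: contrapT => ab0; apply: (fS (a, b)) => //.
  by split=> // -[a0 b0]; apply: ab0.
pose g : {additive G -> G} := F \o @inl_fun G G.
have gI : {in @divisible_socle G &, injective g}.
  move=> a b /set_mem aX /set_mem bX /eqP; rewrite -subr_eq0 -raddfB => /eqP.
  move=> /F0[||/eqP + _]; last by rewrite subr_eq0 => /eqP.
    by apply: divisible_socleD => //; exact: divisible_socleN.
  exact: divisible_socle0.
(* An injective self-map of a finite set is onto. *)
have [x1 Xx1 gx1] : exists2 x, divisible_socle x & g x = F (0, x0).
  have X0 : divisible_socle (F (0, x0)) :=
    divisible_socle_additive (F \o @inr_fun G G) Xx0.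
  have /finite_fsetP[A AX] := finX.
  have gA : (g @` A)%fset = A.
    apply/eqP; rewrite eqEfcard card_in_imfset /= ?leqnn ?andbT.
      apply/fsubsetP => _ /imfsetP[a /= aA ->].
      have : [set` A] (g a) 
        by rewrite -AX; apply: divisible_socle_additive; rewrite AX.
      by [].
    by move=> a b aA bA; apply: gI; rewrite inE AX.
  have : [set` A] (F (0, x0)) by rewrite -AX.
  by rewrite /= -{1}gA => /imfsetP[x /= xA ->]; exists x => //; rewrite AX.
(* The pair [(- x1, x0)] is killed by [F] although [x0] is nonzero. *)
have [|//||_ /x00//] := F0 (- x1) x0; first exact: divisible_socleN.
have -> : (- x1, x0) = - (@inl_fun G G x1) + @inr_fun G G x0.
  by rewrite -[RHS]/(_, _) /= oppr0 add0r addr0.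
by rewrite raddfD raddfN; apply/eqP; rewrite addrC subr_eq0 -gx1.
Qed.

End DivisibleSocle.

Lemma prufer_divisible_socle_finite (p : prime_nat) M :
  finite_set (@divisible_socle (val p) M (prufer p)).
Proof.
apply: sub_finite_set
  (finite_image (fun m => prufer_gen p 1 *+ m) (finite_II (val p))).
by move=> x [/prufer_socle[m [mp ->]] _]; exists m.
Qed.

Lemma prufer_gen1_divisible_socle (p : prime_nat) M :
  divisible_socle (val p) M (prufer_gen p 1).
Proof.
split=> [|m _]; last first.
  by exists (prufer_gen p (1 + m)); rewrite prufer_genM.
by rewrite -[X in _ *+ X]expn1 (prufer_genM p 0 1) prufer_gen0.
Qed.

Lemma neq_prime_coprime (p q : prime_nat) n :
  q <> p -> coprime (val p) (val q ^ n).
Proof.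
move=> qp; apply: coprimeXr; rewrite prime_coprime ?(valP p) //.
by rewrite dvdn_prime2 ?(valP p) ?(valP q) //; apply/eqP => /val_inj /esym.
Qed.

(** * The Szmielew group *)

Lemma torsion_free_rat : torsion_free rat.
Proof.
move=> x n n0 /eqP; rewrite mulrn_eq0 => /orP[/eqP n00|/eqP//].
by rewrite n00 in n0.
Qed.

Lemma torsion_free_zlocal p : torsion_free (zlocal p).
Proof.
move=> x n n0 /(congr1 val); rewrite raddfMn raddf0.
move=> /(torsion_free_rat n0) x0.
exact: val_inj.
Qed.

Lemma infinite_preimage_subset (T U : Type) (f : T -> U) (A : set U) :
  injective f -> infinite_set [set: T] -> (forall x, A (f x)) -> infinite_set A.
Proof.
move=> fI infT Af finA; apply: infT.
apply: sub_finite_set (finite_preimage (B := A) _ finA) => [x _|].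
  exact: Af.
exact: in2W.
Qed.

Lemma card_index_finite c n : c = Fin n -> finite_set [set: card_index c].
Proof. by move=> ->; exact: (@finite_finset 'I_n). Qed.

Lemma card_index_infinite c : c = Omega -> infinite_set [set: card_index c].
Proof. by move=> ->; exact: infinite_nat. Qed.

Lemma card_index_inhabited c : inhabited (card_index c) <-> c <> Fin 0.
Proof.
split=> [[x] c0|]; first by move: x; rewrite c0 => -[].
by case: c => [[|n] // _|_]; [exact: inhabits ord0|exact: inhabits 0%N].
Qed.

Section Szmielew.
Variables (kappa : prime_nat -> nat -> countable_cardinal)
          (lambda mu : prime_nat -> countable_cardinal)
          (nu : countable_cardinal).

(** The nesting follows the products in [szmielew]: cyclic, Pruefer and Z_(p) summands for each p,
    then the copies of Q. *)
Definition summand_index : Type :=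
  ({p : prime_nat & ({k : nat & card_index (kappa p k)} + card_index (lambda p))
                    + card_index (mu p)}
   + card_index nu)%type.

Definition cyclic_sum p : zmodType :=
  direct_sum (fun k : nat => copies (kappa p k) 'Z_(val p ^ k.+1)).
Definition torsion_sum p : zmodType :=
  (cyclic_sum p * copies (lambda p) (prufer p))%type.
Definition component p : zmodType :=
  (torsion_sum p * copies (mu p) (zlocal p))%type.

Definition cyclic_family p : {k & card_index (kappa p k)} -> zmodType :=
  sigma_family (fun k _ => 'Z_(val p ^ k.+1)).
Definition torsion_family p :
    ({k & card_index (kappa p k)} + card_index (lambda p)) -> zmodType :=
  sum_family (cyclic_family (p := p)) (fun=> prufer p).
Definition component_family p :
    ({k & card_index (kappa p k)} + card_index (lambda p) + card_index (mu p))
    -> zmodType :=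
  sum_family (torsion_family (p := p)) (fun=> zlocal p).

Definition summand : summand_index -> zmodType :=
  sum_family (sigma_family component_family) (fun=> rat).

Definition component_coordinates p :
    coordinates (component p) (component_family (p := p)) :=
  pair_coordinates (G := torsion_sum p)
    (pair_coordinates (G := cyclic_sum p)
      (refine_coordinates
        (dsum_coordinates (fun k => copies (kappa p k) 'Z_(val p ^ k.+1)))
        (fun k => dsum_coordinates
           (fun _ : card_index (kappa p k) => 'Z_(val p ^ k.+1))))
       (dsum_coordinates (fun _ : card_index (lambda p) => prufer p)))
    (dsum_coordinates (fun _ : card_index (mu p) => zlocal p)).

(* Unifying the two sides inside the definition of the coordinates is slow. *)
Lemma szmielewE :
  szmielew kappa lambda mu nu = (direct_sum component * copies nu rat)%type.
Proof. by []. Qed.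

Lemma szmielew_coordinates : coordinates (szmielew kappa lambda mu nu) summand.
Proof.
rewrite szmielewE; apply: pair_coordinates (dsum_coordinates _).
exact: refine_coordinates (dsum_coordinates _) component_coordinates.
Qed.

Definition cyclic_index p k (c : card_index (kappa p k)) : summand_index :=
  inl (existT _ p (inl (inl (existT _ k c)))).
Definition prufer_index p (c : card_index (lambda p)) : summand_index :=
  inl (existT _ p (inl (inr c))).

End Szmielew.

(** * Sufficiency of the condition *)

Section Sufficiency.
Variables (kappa : prime_nat -> nat -> countable_cardinal)
          (lambda mu : prime_nat -> countable_cardinal)
          (nu : countable_cardinal).

Local Notation A := (szmielew kappa lambda mu nu).
Local Notation index := (summand_index kappa lambda mu nu).
Local Notation summand := (@summand kappa lambda mu nu).
Local Notation coords := (szmielew_coordinates kappa lambda mu nu).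

Lemma leq_max_cyclic_exponent p n : finite_set (cyclic_exponents kappa p) ->
  cyclic_exponents kappa p n -> (n <= max_cyclic_exponent kappa p)%N.
Proof.
move=> fin pn; apply: (leq_bigmax_seq n) => //.
by rewrite in_fset_set // inE.
Qed.

(** Were the maximum not attained, its predecessor would bound all exponents, hence the maximum
    itself. *)
Lemma max_cyclic_exponent_mem p : finite_set (cyclic_exponents kappa p) ->
  cyclic_exponents kappa p !=set0 ->
  cyclic_exponents kappa p (max_cyclic_exponent kappa p).
Proof.
move=> fin [n pn]; apply: contrapT => maxN.
have max0 : (0 < max_cyclic_exponent kappa p)%N.
  by apply: leq_trans (leq_max_cyclic_exponent fin pn); case: pn.
suff : (max_cyclic_exponent kappa p <= (max_cyclic_exponent kappa p).-1)%N.
  by rewrite -{1}(prednK max0) ltnn.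
apply/bigmax_leqP_seq => m; rewrite in_fset_set // inE => pm _.
rewrite -ltnS prednK // ltn_neqAle leq_max_cyclic_exponent // andbT.
by apply/eqP => mE; apply: maxN; rewrite -mE.
Qed.

Definition receives (G : zmodType) (v : G) (j : index) :=
  exists h : {additive G -> summand j}, h v <> 0.

Lemma infinite_receives_prufer p (G : zmodType) (v : G) : lambda p = Omega ->
  (exists h : {additive G -> prufer p}, h v <> 0) -> infinite_set (receives v).
Proof.
move=> lp [h hv].
apply: (infinite_preimage_subset (f := @prufer_index kappa lambda mu nu p)).
- by move=> c d e; exact: inr_inj (inl_inj (existT_inj (inl_inj e))).
- exact: card_index_infinite.
- by move=> c; exists h.
Qed.

(** Every cyclic p-summand of exponent at least [k.+1] can receive [v]. Either the largest exponent
    has infinitely many copies, or there are infinitely many exponents. *)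
Lemma infinite_receives_cyclic p k (v : 'Z_(val p ^ k.+1)) :
  (finite_set (cyclic_exponents kappa p) ->
    kappa p (max_cyclic_exponent kappa p).-1 = Omega) ->
  kappa p k <> Fin 0 -> v <> 0 -> infinite_set (receives v).
Proof.
move=> maxp kp v0; have pp := valP p.
have [fin|inf] := pselect (finite_set (cyclic_exponents kappa p)).
  set l := (max_cyclic_exponent kappa p).-1 in maxp.
  apply: (infinite_preimage_subset (f := @cyclic_index kappa lambda mu nu p l)).
  - move=> c d e.
    exact: existT_inj (inl_inj (inl_inj (existT_inj (inl_inj e)))).
  - exact/card_index_infinite/maxp.
  - move=> c; apply: cyclic_map_cyclic => //.
    have kl : (k.+1 <= max_cyclic_exponent kappa p)%N.
      exact: leq_max_cyclic_exponent.
    by rewrite -ltnS prednK //; exact: leq_ltn_trans kl.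
move=> finR; apply: inf.
(* [level] is the exponent of a cyclic coordinate and 0 elsewhere. If few coordinates received [v],
   their levels and the numbers up to [k] would form a finite set containing all exponents at p. *)
pose level (j : index) := match j with
  | inl (existT _ (inl (inl (existT l _)))) => l.+1 | _ => 0%N end.
have : finite_set (`I_(k.+1) `|` (level @` receives v)).
  by rewrite finite_setU; split; [exact: finite_II|exact: finite_image].
apply: sub_finite_set => -[|l] [//= _ lp].
have [kl|lk] := leqP k l; last by left.
right; have [c] := (card_index_inhabited _).2 lp.
exists (@cyclic_index kappa lambda mu nu p l c) => //.
exact: cyclic_map_cyclic.
Qed.

Hypothesis cond : forall p : prime_nat,
  lambda p = Omega \/ (lambda p = Fin 0 /\
    (finite_set (cyclic_exponents kappa p) -> cyclic_exponents kappa p !=set0 ->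
     kappa p (max_cyclic_exponent kappa p).-1 = Omega)).

(** If [lambda p] is infinite, cyclic and Pruefer p-summands both map to the Pruefer coordinates; if
    it is 0, only cyclic torsion remains at p. *)
Lemma summand_receives (j : index) : torsion_free (summand j) \/
  forall v : summand j, v <> 0 -> infinite_set (receives v).
Proof.
case: j => [[p [[[k c]|c]|c]]|c].
- right=> v v0; have [lp|[lp maxp]] := cond p.
    by apply: (infinite_receives_prufer lp); exact: cyclic_map_prufer.
  have kp : kappa p k <> Fin 0 by exact/card_index_inhabited.
  by apply: infinite_receives_cyclic => // fin; apply: maxp => //; exists k.+1.
- right=> v v0; have [lp|[lp _]] := cond p.
    by apply: (infinite_receives_prufer lp); exists idfun.
  by have /card_index_inhabited := inhabits c.
- by left; exact: torsion_free_zlocal.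
- by left; exact: torsion_free_rat.
Qed.

Lemma szmielew_discriminating : discriminating (GRing.to_multiplicative A).
Proof.
move=> H sep S finS S1; have /finite_seqP[s SE] := finS.
have [x xs|f fD fs] := @coordinates_discriminate H _ _ _ coords s.
  have x1 : x <> 1%g by apply: S1; rewrite SE.
  have [f fx] := sep x x1; have [j jx] := cproj_sep coords fx.
  have fjD : grp_additive (fun y => cproj coords j (f y : A)).
    by move=> y z; rewrite -raddfD (@gmulfM _ _ f).
  have [tf|inf] := summand_receives j.
    by right; exists j => //; exists (fun y => cproj coords j (f y : A)).
  (* Composing the [j]-th coordinate of [f] with maps out of [summand j] detects [x] in infinitely
     many places. *)
  left; apply: sub_infinite_set (inf _ jx) => i [h hx].
  exists (fun y => h (cproj coords j (f y : A))) => // y z.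
  by rewrite fjD raddfD.
have f1 : f 1%g = 0 by apply: (addrI (f 1%g)); rewrite -fD mulg1 addr0.
pose fM := isUMagmaMorphism.Build H (GRing.to_multiplicative A) f (f1, fD).
pose fU : UMagmaMorphism.type H (GRing.to_multiplicative A) := HB.pack f fM.
by exists fU => x; rewrite SE => /fs.
Qed.

End Sufficiency.

(** * Necessity of the condition *)

Section Necessity.
Variables (kappa : prime_nat -> nat -> countable_cardinal)
          (lambda mu : prime_nat -> countable_cardinal)
          (nu : countable_cardinal).

Local Notation A := (szmielew kappa lambda mu nu).
Local Notation index := (summand_index kappa lambda mu nu).
Local Notation summand := (@summand kappa lambda mu nu).
Local Notation coords := (szmielew_coordinates kappa lambda mu nu).

(** The hypotheses make X vanish outside [F]: small cyclic p-summands are killed by some p^m with m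
    in [M], other primes contribute no p-torsion, nor do the torsion-free summands. Each X(W_j) is
    finite, hence so is X(A). *)
Lemma finite_family_not_discriminating p M (F : set index) j (x : summand j) :
  finite_set F ->
  (forall q k c, ~ F (@cyclic_index kappa lambda mu nu q k c) -> q = p ->
     exists2 m, M m & (k < m)%N) ->
  (forall q c, ~ F (@prufer_index kappa lambda mu nu q c) -> q <> p) ->
  divisible_socle (val p) M x -> x <> 0 ->
  ~ discriminating (GRing.to_multiplicative A).
Proof.
move=> finF cycF pruF xX x0; have pp := valP p.
apply: (@finite_divisible_socle_not_discriminating (val p) M A
  (cinj coords j x)).
- apply: (divisible_socle_coordinates_finite coords finF).
    move=> [[q [[[k c]|c]|c]]|c] Fj y yX.
    + have [qp|qp] := pselect (q = p); last first.
        apply: (coprime_divisible_socle (neq_prime_coprime k.+1 qp)) yX.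
        exact/Zp_mulrn_eq0/expn_prime_gt1/(valP q).
      have [m Mm km] := cycF _ _ _ Fj qp.
      rewrite -qp in yX; exact: cyclic_divisible_socle (valP q) Mm km yX.
    + have qp := pruF _ _ Fj; have [e ye] := prufer_torsion y.
      exact: (coprime_divisible_socle (neq_prime_coprime e qp) ye yX).
    + exact: torsion_free_divisible_socle (@torsion_free_zlocal q) yX.
    + exact: torsion_free_divisible_socle torsion_free_rat yX.
  move=> [[q [[[k c]|c]|c]]|c] _.
  + exact: (@finite_finset 'Z_(val q ^ k.+1)).
  + have [qp|qp] := pselect (q = p); last first.
      apply: sub_finite_set (finite_set1 (0 : prufer q)) => y yX.
      have [e ye] := prufer_torsion y.
      exact: (coprime_divisible_socle (neq_prime_coprime e qp) ye yX).
    by rewrite -qp; exact: prufer_divisible_socle_finite.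
  + apply: sub_finite_set (finite_set1 (0 : zlocal q)) => y yX.
    exact: torsion_free_divisible_socle (@torsion_free_zlocal q) yX.
  + apply: sub_finite_set (finite_set1 (0 : rat)) => y yX.
    exact: torsion_free_divisible_socle torsion_free_rat yX.
- exact: divisible_socle_additive.
- by move=> /(congr1 (cproj coords j)); rewrite cprojK raddf0.
Qed.

Lemma discriminating_cond p : discriminating (GRing.to_multiplicative A) ->
  lambda p = Omega \/ (lambda p = Fin 0 /\
    (finite_set (cyclic_exponents kappa p) -> cyclic_exponents kappa p !=set0 ->
     kappa p (max_cyclic_exponent kappa p).-1 = Omega)).
Proof.
move=> disc; case lp : (lambda p) => [[|n]|]; [right|exfalso|by left].
  split=> // fin ne; case kE : (kappa p _) => [n|//]; exfalso.
  set l := (max_cyclic_exponent kappa p).-1 in kE.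
  have [max0 maxp] := max_cyclic_exponent_mem fin ne.
  have [c] := (card_index_inhabited _).2 maxp.
  (* Here [l] is l_p - 1. Divisibility by p^l kills X in the cyclic p-summands of smaller exponent,
     which leaves the finitely many copies of Z(p^(l+1)); p^l in one copy is the nonzero element. *)
  move: disc; apply: (@finite_family_not_discriminating p [set l]
    (range (@cyclic_index kappa lambda mu nu p l))
    (@cyclic_index kappa lambda mu nu p l c) (1 *+ (val p ^ l))).
  - exact/finite_image/(card_index_finite kE).
  - move=> q k d Fd qp; exists l => //; move: d Fd; rewrite {}qp => d Fd.
    have : cyclic_exponents kappa p k.+1.
      by split=> //; exact/card_index_inhabited.
    move=> /(leq_max_cyclic_exponent fin); rewrite -(prednK max0) ltnS -/l.
    rewrite leq_eqVlt => /predU1P[kl|//]; exfalso; apply: Fd.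
    by move: d; rewrite kl => d; exists d.
  - by move=> q d _ qp; move: d; rewrite qp lp => -[].
  - split=> [|m ->]; last by exists 1.
    by rewrite -mulrnA -expnSr Zp_mulrn_eq0 // expn_prime_gt1 ?(valP p).
  - move=> /(congr1 val); rewrite /= val_Zp_nat ?expn_prime_gt1 ?(valP p) //.
    rewrite modn_small ?ltn_exp2l ?prime_gt1 ?(valP p) // => /eqP.
    by rewrite expn_eq0 -leqn0 leqNgt prime_gt0 ?(valP p).
have [c] : inhabited (card_index (lambda p)).
  by apply/card_index_inhabited; rewrite lp.
(* Divisibility by all powers of p removes every cyclic p-summand and leaves the finitely many
   Pruefer ones; the class of 1/p is the nonzero element. *)
move: disc; apply: (@finite_family_not_discriminating p setT
    (range (@prufer_index kappa lambda mu nu p))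
    (@prufer_index kappa lambda mu nu p c) (prufer_gen p 1)).
- exact/finite_image/(card_index_finite lp).
- by move=> q k d _ _; exists k.+1.
- by move=> q d Fd qp; move: d Fd; rewrite qp => d; apply; exists d.
- exact: prufer_gen1_divisible_socle.
- exact: prufer_gen1.
Qed.

End Necessity.

Theorem proposition2p1
    (kappa : prime_nat -> nat -> countable_cardinal)
    (lambda mu : prime_nat -> countable_cardinal)
    (nu : countable_cardinal) :
  discriminating (GRing.to_multiplicative (szmielew kappa lambda mu nu))
  <->
  (forall p : prime_nat,
     lambda p = Omega
     \/ (lambda p = Fin 0
         /\ (finite_set (cyclic_exponents kappa p) ->
             cyclic_exponents kappa p !=set0 ->
             kappa p (max_cyclic_exponent kappa p).-1 = Omega))).
Proof.
split=> [disc p|cond]; first exact: discriminating_cond disc.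
exact: szmielew_discriminating.
Qed.
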